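(* Assume $p_t>0$ and let $g_{\text{opt}}(\mathbf{x})=p_t^{-1}\psi_t(\mathbf{x})f_{\mathbf{X}}(\mathbf{x})$ for $\mathbf{x}\in\mathbb{X}$. Let $u\subseteq\{1,\dots,d\}$ with $u\neq\varnothing$, $u\neq\{1,\dots,d\}$, and let $N\ge 2$, $N_u\ge 1$ be integers. When the auxiliary density is $g=g_{\text{opt}}$, the estimator $\widehat{\text{T-VE}}_{u,\text{PF}}^{\text{IS}}$ defined in the context satisfies $$\mathbb{V}_{g_{\text{opt}}}\left(\widehat{\text{T-VE}}_{u,\text{PF}}^{\text{IS}}\right)\le\frac{p_t^2}{N_u}.$$
   Context: $\mathbb{X}=\mathbb{X}_1\times\dots\times\mathbb{X}_d\subseteq\mathbb{R}^d$; $\mathbf{X}=(X_1,\dots,X_d)$ is a random vector in $\mathbb{X}$ with joint density $f_{\mathbf{X}}$ (components possibly dependent); $\phi:\mathbb{X}\to\mathbb{R}$ is a measurable function, $t\in\mathbb{R}$, $\psi_t(\mathbf{x})=\mathbf{1}(\phi(\mathbf{x})>t)$ and $p_t=\mathbb{P}(\phi(\mathbf{X})>t)$. For $u\subseteq\{1,\dots,d\}$, $-u=\{1,\dots,d\}\setminus u$, and $(\mathbf{x}_u,\mathbf{x}_{-u})$ denotes the vector of $\mathbb{X}$ with these sub-vectors. For a probability density $g$ on $\mathbb{X}$, $f_{\mathbf{X}_u}$ and $g_{\mathbf{X}_u}$ are the marginal densities on the coordinates $u$ of $f_{\mathbf{X}}$ and $g$; $g_{\mathbf{X}_{-u}|\mathbf{X}_u=\mathbf{x}_u}$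 is the conditional density under $g$. $\mathbb{V}_g$ denotes the variance when the samples are drawn from $g$ as described below. Define $w_t^g(\mathbf{x})=\psi_t(\mathbf{x})f_{\mathbf{X}}(\mathbf{x})/g(\mathbf{x})$, with the convention $0/0=0$ (any term involving a factor $w_t^g(\mathbf{x}_u,\mathbf{x}_{-u})$ with $f_{\mathbf{X}_u}(\mathbf{x}_u)=0$ is set to $0$). Samples: $(\mathbf{X}_u^{(n)})_{1\le n\le N_u}$ is i.i.d. with density $g_{\mathbf{X}_u}$; for each $n$, conditionally on $\mathbf{X}_u^{(n)}$, $\mathbf{X}_{-u}^{(n,1)},\mathbf{X}_{-u}^{(n,2)}$ are independent with density $g_{\mathbf{X}_{-u}|\mathbf{X}_u=\mathbf{X}_u^{(n)}}$ (independently across $n$). With $(\mathbf{X}^{(n)})_{1\le n\le N}$ i.i.d. with density $g$, let $\widehat{p}_{t,N}^{\text{IS}}=\frac1N\sum_{n=1}^N w_t^g(\mathbf{X}^{(n)})$ and $$\widehat{p}_{t,N}^{\text{IS},\text{ub}}=\left(\widehat{p}_{t,N}^{\text{IS}}\right)^2-\frac1{N-1}\left[\frac1N\sum_{n=1}^N w_t^g(\mathbf{X}^{(n)})^2-\left(\widehat{p}_{t,N}^{\text{IS}}\right)^2\right].$$ Estimator: $$\widehat{\text{T-VE}}_{u,\text{PF}}^{\text{IS}}=\frac1{N_u}\sum_{n=1}^{N_u}w_t^g\left(\mathbf{X}_u^{(n)},\mathbf{X}_{-u}^{(n,1)}\right)w_t^g\left(\mathbf{X}_u^{(n)},\mathbf{X}_{-u}^{(n,2)}\right)\frac{g_{\mathbf{X}_u}(\mathbf{X}_u^{(n)})}{f_{\mathbf{X}_u}(\mathbf{X}_u^{(n)})}-\widehat{p}_{t,N}^{\text{IS},\text{ub}}.$$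 *)

(* Defs.v *)
From HB Require Import structures.
From mathcomp Require Import all_boot all_order all_algebra.
From mathcomp Require Import all_classical all_reals all_analysis.

Set Implicit Arguments.
Unset Strict Implicit.
Unset Printing Implicit Defensive.
Import Order.TTheory GRing.Theory Num.Theory.
Import numFieldNormedType.Exports.
Local Open Scope classical_set_scope.
Local Open Scope ring_scope.

(* Points of [R^n] are tuples [n.-tuple R], with the product of the Borel
   sigma-algebras. *)

Lemma sigma_finite_product {R : realType} {d1 d2 : measure_display}
    {T1 : measurableType d1} {T2 : measurableType d2}
    (m1 : {sigma_finite_measure set T1 -> \bar R})
    (m2 : {sigma_finite_measure set T2 -> \bar R}) :
  sigma_finite setT (m1 \x m2)%E.
Proof.
have /sigma_finiteP[F [TF ndF Foo]] := sigma_finiteT m1.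
have /sigma_finiteP[G [TG ndG Goo]] := sigma_finiteT m2.
exists (fun n => F n `*` G n) => [|k].
  rewrite -setXTT TF TG predeqE => -[x y]; split.
    move=> [/= [n _ Fnx] [k _ Gky]]; exists (maxn n k) => //; split.
    - by move: x Fnx; exact/subsetPset/ndF/leq_maxl.
    - by move: y Gky; exact/subsetPset/ndG/leq_maxr.
  by move=> [n _ []/= ? ?]; split; exists n.
have [? ?] := Foo k; have [? ?] := Goo k.
split; first exact: measurableX.
by rewrite product_measure1E// lte_mul_pinfty// ge0_fin_numE.
Qed.

Section lebesgue_tuple.
Context {R : realType}.

Definition cons_pair n (p : R * n.-tuple R) : n.+1.-tuple R :=
  [tuple of p.1 :: p.2].

Definition lebesgue_cons n (mu : set (n.-tuple R) -> \bar R) :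
    set (n.+1.-tuple R) -> \bar R :=
  pushforward (lebesgue_measure \x mu)%E (@cons_pair n).

(* The n-fold product of [lebesgue_measure]. *)
Fixpoint lebesgue_tuple n : set (n.-tuple R) -> \bar R :=
  match n with
  | 0 => \d_[tuple]
  | m.+1 => lebesgue_cons (@lebesgue_tuple m)
  end.

Lemma measurable_cons_pair n : measurable_fun [set: _] (@cons_pair n).
Proof. exact: measurable_cons. Qed.

Section lebesgue_cons_sigma_finite.
Context n (mu : {sigma_finite_measure set (n.-tuple R) -> \bar R}).

Let lc0 : lebesgue_cons mu set0 = 0%E.
Proof. by rewrite /lebesgue_cons /pushforward preimage_set0 measure0. Qed.

Let lc_ge0 A : (0 <= lebesgue_cons mu A)%E.
Proof. exact: (measure_ge0 (lebesgue_measure \x mu)%E). Qed.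

Let lc_sigma_additive : semi_sigma_additive (lebesgue_cons mu).
Proof.
have mc := @measurable_cons_pair n.
move=> F mF tF mUF; rewrite /lebesgue_cons /pushforward preimage_bigcup.
apply: measure_semi_sigma_additive.
- by move=> k; rewrite -[X in measurable X]setTI; exact: mc.
- apply/trivIsetP => /= i j _ _ ij; rewrite -preimage_setI.
  by move/trivIsetP : tF => /(_ _ _ _ _ ij) ->//; rewrite preimage_set0.
- by rewrite -preimage_bigcup -[X in measurable X]setTI; exact: mc.
Qed.

HB.instance Definition _ := isMeasure.Build _ _ _ (lebesgue_cons mu)
  lc0 lc_ge0 lc_sigma_additive.

Let uncons (v : n.+1.-tuple R) : R * n.-tuple R :=
  (thead v, [tuple of behead v]).

Let cons_pairK : cancel (@cons_pair n) uncons.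
Proof. by move=> [x v]; congr pair; apply/val_inj. Qed.

Let measurable_uncons : measurable_fun [set: _] uncons.
Proof.
apply/measurable_fun_pair; first exact: measurable_tnth.
exact: measurable_behead.
Qed.

Let lc_sigma_finite : sigma_finite setT (lebesgue_cons mu).
Proof.
have [F TF Foo] := sigma_finite_product (@lebesgue_measure R) mu.
exists (fun k => uncons @^-1` F k) => [|k].
  by rewrite -preimage_bigcup -TF preimage_setT.
have [mF Fk] := Foo k; split.
  by rewrite -[X in measurable X]setTI; exact: measurable_uncons.
rewrite /lebesgue_cons /pushforward.
suff -> : @cons_pair n @^-1` (uncons @^-1` F k) = F k by [].
by apply/funext => p; rewrite /preimage /= cons_pairK.
Qed.

HB.instance Definition _ := Measure_isSigmaFinite.Build _ _ _
  (lebesgue_cons mu) lc_sigma_finite.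

End lebesgue_cons_sigma_finite.

Lemma lebesgue_tuple_sigma_finite_subproof n :
  {mu : {sigma_finite_measure set (n.-tuple R) -> \bar R} |
    lebesgue_tuple (n := n) = mu}.
Proof.
elim: n => [|n [mu IH]]; first by exists (\d_[tuple])%E.
by exists (lebesgue_cons mu); rewrite /= IH.
Qed.

Section instances.
Variable n : nat.

Let lt0 : @lebesgue_tuple n set0 = 0%E.
Proof. by have [mu ->] := lebesgue_tuple_sigma_finite_subproof n. Qed.

Let lt_ge0 A : (0 <= @lebesgue_tuple n A)%E.
Proof. by have [mu ->] := lebesgue_tuple_sigma_finite_subproof n. Qed.

Let lt_sigma_additive : semi_sigma_additive (@lebesgue_tuple n).
Proof.
have [mu ->] := lebesgue_tuple_sigma_finite_subproof n.
exact: measure_semi_sigma_additive.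
Qed.

HB.instance Definition _ := isMeasure.Build _ _ _ (@lebesgue_tuple n)
  lt0 lt_ge0 lt_sigma_additive.

Let lt_sigma_finite : sigma_finite setT (@lebesgue_tuple n).
Proof.
have [mu ->] := lebesgue_tuple_sigma_finite_subproof n.
exact: sigma_finiteT.
Qed.

HB.instance Definition _ := Measure_isSigmaFinite.Build _ _ _
  (@lebesgue_tuple n) lt_sigma_finite.

End instances.

End lebesgue_tuple.
Arguments lebesgue_tuple {R n} _.

Section densities.
Context {R : realType} {d : nat}.
Implicit Types (u : {set 'I_d}) (g : d.-tuple R -> R).

Definition box (XX : 'I_d -> set R) : set (d.-tuple R) :=
  [set x | forall i, XX i (tnth x i)].

(* A density on a subset [D] of [R^d] is extended by zero outside of [D]. *)
Definition density_on (D : set (d.-tuple R)) g : Prop :=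
  [/\ measurable_fun [set: d.-tuple R] g,
      forall x, 0 <= g x,
      forall x, ~ D x -> g x = 0 &
      (\int[lebesgue_tuple]_x (g x)%:E = 1)%E].

(* [(x_u, x_{-u})]: the coordinates in [u], resp. in its complement, are listed
   in increasing order in [xu], resp. in [xv]. *)
Definition join_coords u (xu : #|u|.-tuple R) (xv : #|~: u|.-tuple R) : d.-tuple R :=
  [tuple if i \in u then nth 0 xu (index i (enum u))
         else nth 0 xv (index i (enum (~: u))) | i < d].

Definition marginal u g (xu : #|u|.-tuple R) : R :=
  \int[lebesgue_tuple]_xv g (join_coords xu xv).

Definition conditional u g (xu : #|u|.-tuple R) (xv : #|~: u|.-tuple R) : R :=
  g (join_coords xu xv) / marginal g xu.

End densities.

Definition has_density {R : realType} {d : measure_display}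
    {Omega : measurableType d} (P : probability Omega R) {n : nat}
    (X : {RV P >-> n.-tuple R}) (g : n.-tuple R -> R) : Prop :=
  forall A, measurable A ->
    distribution P X A = (\int[lebesgue_tuple]_(x in A) (g x)%:E)%E.

(* As the [A i] may be [setT], this contains the product rule for all the
   subfamilies. *)
Definition mutually_independent {R : realType} {d d' : measure_display}
    {Omega : measurableType d} {T : measurableType d'}
    (P : probability Omega R) {I : finType} (X : I -> Omega -> T) : Prop :=
  forall A : I -> set T, (forall i, measurable (A i)) ->
    P (\bigcap_(i in [set: I]) X i @^-1` A i) =
    (\prod_(i : I) P (X i @^-1` A i))%E.

Section sampling.
Context {R : realType} {dim : nat} {d : measure_display}
  {Omega : measurableType d} (Q : probability Omega R).
Implicit Types g : dim.-tuple R -> R.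

Definition iid_sample g {N : nat} (X : 'I_N -> {RV Q >-> dim.-tuple R}) : Prop :=
  mutually_independent Q (fun n => X n : Omega -> dim.-tuple R) /\
  forall n, has_density (X n) g.

(* The last clause says that, conditionally on [Xu n], the vectors [X1 n] and
   [X2 n] are independent with density [conditional g (Xu n)]. *)
Definition pick_freeze_sample g {u : {set 'I_dim}} {N : nat}
    (Xu : 'I_N -> {RV Q >-> #|u|.-tuple R})
    (X1 X2 : 'I_N -> {RV Q >-> #|~: u|.-tuple R}) : Prop :=
  [/\ mutually_independent Q (fun n w => (Xu n w, (X1 n w, X2 n w))),
      forall n, has_density (Xu n) (marginal g) &
      forall n A B1 B2, measurable A -> measurable B1 -> measurable B2 ->
        Q (Xu n @^-1` A `&` (X1 n @^-1` B1 `&` X2 n @^-1` B2)) =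
        (\int[Q]_(w in Xu n @^-1` A)
          ((\int[lebesgue_tuple]_(y in B1) (conditional g (Xu n w) y)%:E) *
           (\int[lebesgue_tuple]_(y in B2) (conditional g (Xu n w) y)%:E)))%E].

End sampling.

Section estimators.
Context {R : realType} {d : nat}.
Variables (f : d.-tuple R -> R) (phi : d.-tuple R -> R) (t : R).
Implicit Types g : d.-tuple R -> R.

Definition psi (x : d.-tuple R) : R := \1_[set y | t < phi y] x.

(* Division by zero yields zero, hence the convention [0 / 0 = 0], here and for
   [marginal g xu / marginal f xu] below. *)
Definition weight g (x : d.-tuple R) : R := psi x * f x / g x.

Definition p_IS g {N : nat} (x : 'I_N -> d.-tuple R) : R :=
  N%:R^-1 * \sum_(n < N) weight g (x n).

Definition p_IS_ub g {N : nat} (x : 'I_N -> d.-tuple R) : R :=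
  p_IS g x ^+ 2 -
  (N%:R - 1)^-1 *
    (N%:R^-1 * (\sum_(n < N) weight g (x n) ^+ 2) - p_IS g x ^+ 2).

Definition TVE_PF_IS g {u : {set 'I_d}} {Nu N : nat}
    (xu : 'I_Nu -> #|u|.-tuple R) (x1 x2 : 'I_Nu -> #|~: u|.-tuple R)
    (x : 'I_N -> d.-tuple R) : R :=
  Nu%:R^-1 *
    (\sum_(n < Nu) weight g (join_coords (xu n) (x1 n)) * weight g (join_coords (xu n) (x2 n))
       * (marginal g (xu n) / marginal f (xu n)))
  - p_IS_ub g x.

End estimators.

Definition exceedance_prob {R : realType} {dim : nat} {d : measure_display}
    {Omega : measurableType d} (P : probability Omega R)
    (X : {RV P >-> dim.-tuple R}) (phi : dim.-tuple R -> R) (t : R) : R :=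
  fine (P [set w | t < phi (X w)]).

Definition g_opt {R : realType} {dim : nat} (f phi : dim.-tuple R -> R)
    (t p : R) (x : dim.-tuple R) : R :=
  p^-1 * psi phi t x * f x.

(* Main.v *)
(* Under [g_opt] the weight takes only the values [0] and [p_t], the latter
   almost surely, so [p_IS_ub] is almost surely the constant [p_t ^ 2] and does
   not contribute to the variance.  As [g_opt <= f / p_t], the quotient of the
   marginals is at most [1 / p_t], so each pick-freeze term lies in
   [[0, p_t ^ 2 / p_t] = [0, p_t]] and has variance at most [p_t ^ 2]; averaging
   [N_u] independent terms divides this bound by [N_u]. *)

Require Import Defs.
From HB Require Import structures.
From mathcomp Require Import all_boot all_order all_algebra.
From mathcomp Require Import all_classical all_reals all_analysis.
From mathcomp Require Import measurable_realfun.

Set Implicit Arguments.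
Unset Strict Implicit.
Unset Printing Implicit Defensive.
Import Order.TTheory GRing.Theory Num.Theory.
Import numFieldNormedType.Exports.
Local Open Scope classical_set_scope.
Local Open Scope ring_scope.

(** * Variance of bounded variables and of averages of uncorrelated ones *)

Section variance_lemmas.
Context d (T : measurableType d) (R : realType) (P : probability T R).

Lemma bounded_Lfun2 (Z : T -> R) (M : R) : measurable_fun [set: T] Z ->
  (forall w, 0 <= Z w <= M) -> Z \in Lfun P 2%:E.
Proof.
move=> mZ ZM; apply/andP; split; rewrite inE//= /finite_norm unlock /Lnorm.
apply: poweR_lty; apply: (@le_lt_trans _ _ (\int[P]_x (M `^ 2)%:E)%E); last first.
  by rewrite integral_cst//= probability_setT mule1 ltry.
apply: ge0_le_integral => //.
- by move=> x _; exact: poweR_ge0.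
- apply/measurable_EFinP.
  apply: (@measurableT_comp _ _ _ _ _ _ (@powR R ^~ 2)) => //.
  exact: measurableT_comp.
- move=> x _; have /andP[Z0 ZleM] := ZM x.
  by rewrite lee_fin ge0_ler_powR// ?nnegrE ?normr_ge0 ?ger0_norm// (le_trans Z0).
Qed.

Lemma expectation_sqr_bounded (Z : T -> R) (M : R) :
  measurable_fun [set: T] Z -> (forall w, 0 <= Z w <= M) ->
  ('E_P[Z ^+ 2] <= (M ^+ 2)%:E)%E.
Proof.
move=> mZ ZM; rewrite -(expectation_cst P (M ^+ 2)).
apply: expectation_le => //.
- exact: measurable_funM.
- by move=> x; exact: sqr_ge0.
- by move=> x; exact: sqr_ge0.
- apply: aeW => x; have /andP[Z0 ZleM] := ZM x.
  by rewrite /cst -[leLHS]/(Z x ^+ 2) lerXn2r// ?nnegrE// (le_trans Z0).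
Qed.

(** The variance is the second moment minus a nonnegative square, and the second moment is at most
    [M ^+ 2]. *)
Lemma variance_bounded (Z : T -> R) (M : R) : measurable_fun [set: T] Z ->
  (forall w, 0 <= Z w <= M) -> ('V_P[Z] <= (M ^+ 2)%:E)%E.
Proof.
move=> mZ ZM; rewrite varianceE ?(bounded_Lfun2 mZ ZM)//.
apply: (le_trans _ (expectation_sqr_bounded mZ ZM)).
by rewrite leeBlDr ?fin_numX ?expectation_fin_num ?leeDl ?sqre_ge0//;
  apply: Lfun_subset12 (bounded_Lfun2 mZ ZM); rewrite fin_num_measure.
Qed.

Lemma ae_eq_expectation (Z Z' : T -> R) :
  measurable_fun [set: T] Z -> measurable_fun [set: T] Z' ->
  (\forall w \ae P, Z w = Z' w) -> ('E_P[Z] = 'E_P[Z'])%E.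
Proof.
move=> mZ mZ' ZZ'; rewrite unlock; apply: ae_eq_integral => //.
- exact/measurable_EFinP.
- exact/measurable_EFinP.
- by apply: filterS ZZ' => w -> .
Qed.

(** This allows an almost surely constant summand to be replaced by its constant inside a
    variance. *)
Lemma ae_eq_variance (Z Z' : T -> R) :
  measurable_fun [set: T] Z -> measurable_fun [set: T] Z' ->
  (\forall w \ae P, Z w = Z' w) -> ('V_P[Z] = 'V_P[Z'])%E.
Proof.
move=> mZ mZ' ZZ'; rewrite /variance unlock (ae_eq_expectation mZ mZ' ZZ').
apply: ae_eq_expectation.
- by apply: measurable_funM; exact: measurable_funB.
- by apply: measurable_funM; exact: measurable_funB.
- by apply: filterS ZZ' => w /= ZZ'w; rewrite /GRing.mul/= ZZ'w.
Qed.

(** Induction on the list: [uniq] makes the head differ from every later index, so its covariance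
    with the sum of the tail vanishes by additivity and the cross term of [varianceD] disappears. *)
Lemma variance_sum_uncorrelated (I : eqType) (s : seq I) (Z : I -> T -> R) :
  uniq s -> (forall i, Z i \in Lfun P 2%:E) ->
  (forall i j, i != j -> covariance P (Z i) (Z j) = 0%E) ->
  ('V_P[(\sum_(i <- s) Z i)%R] = \sum_(i <- s) 'V_P[Z i])%E.
Proof.
move=> + Z2 Z0.
have S2 (r : seq I) : \sum_(i <- r) Z i \in Lfun P 2%:E.
  by elim: r => [|i r IH]; rewrite ?big_nil ?big_cons ?rpred0 ?rpredD// ?lee1n.
have cov0 i r : i \notin r -> covariance P (Z i) (\sum_(j <- r) Z j) = 0%E.
  elim: r => [_|j r IH]; first by rewrite big_nil covariance_cst_r.
  rewrite inE negb_or => /andP[ij ir].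
  by rewrite big_cons covarianceDr// Z0// IH// adde0.
elim: s => [_|i s IH]; first by rewrite !big_nil; exact: variance_cst.
move=> /= /andP[iN us].
by rewrite !big_cons varianceD// IH// cov0// mule0 adde0.
Qed.

(** The factor [n%:R^-1] comes out squared, and the sum contributes at most [n] times [M ^+ 2]. *)
Lemma variance_mean_le (n : nat) (Z : 'I_n -> T -> R) (M : R) :
  (0 < n)%N -> (forall i, measurable_fun [set: T] (Z i)) ->
  (forall i w, 0 <= Z i w <= M) ->
  (forall i j, i != j -> covariance P (Z i) (Z j) = 0%E) ->
  ('V_P[(n%:R^-1 \o* \sum_(i < n) Z i)%R] <= (M ^+ 2 / n%:R)%:E)%E.
Proof.
move=> n0 mZ ZM Z0.
have Z2 i : Z i \in Lfun P 2%:E by exact: bounded_Lfun2 (mZ i) (ZM i).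
rewrite varianceZ ?rpred_sum ?lee1n//.
rewrite variance_sum_uncorrelated ?index_enum_uniq//.
apply: (@le_trans _ _ ((n%:R^-1 ^+ 2)%:E * \sum_(i < n) (M ^+ 2)%:E)%E).
  rewrite lee_wpmul2l ?lee_fin ?sqr_ge0// lee_sum// => i _.
  exact: variance_bounded.
rewrite sumEFin -EFinM lee_fin sumr_const card_ord -(mulr_natr (M ^+ 2)).
by rewrite mulrCA (expr2 n%:R^-1) mulfVK// pnatr_eq0 -lt0n.
Qed.

End variance_lemmas.

(** * From independence of events to vanishing covariances *)

Section independence.
Context d d' (Omega : measurableType d) (T : measurableType d') (R : realType)
  (P : probability Omega R).

(** The product rule is applied to the family equal to [A] at [i], [B] at [j] and the full set
    elsewhere; the other factors are all 1. *)
Lemma mutually_independent_pair (I : finType) (Y : I -> Omega -> T) (i j : I)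
    (A B : set T) : mutually_independent P Y -> i != j ->
  measurable A -> measurable B ->
  P (Y i @^-1` A `&` Y j @^-1` B) = (P (Y i @^-1` A) * P (Y j @^-1` B))%E.
Proof.
move=> indepY ij mA mB.
pose C k := if k == i then A else if k == j then B else setT.
have mC k : measurable (C k) by rewrite /C; case: ifP => // _; case: ifP.
have := indepY C mC.
have -> : \bigcap_(k in [set: I]) Y k @^-1` C k = Y i @^-1` A `&` Y j @^-1` B.
  apply/seteqP; split => [w YC|w [wA wB] k _].
    split; first by have := YC i Logic.I; rewrite /C/= eqxx.
    by have := YC j Logic.I; rewrite /C/= eq_sym (negbTE ij) eqxx.
  by rewrite /C /=; case: eqP => [->//|_]; case: eqP => [->|].
move=> ->; rewrite (bigD1 i)//= (bigD1 j) 1?eq_sym//= big1 ?mule1.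
  by rewrite /C eqxx eq_sym (negbTE ij) eqxx.
move=> k /andP[ki kj].
by rewrite /C (negbTE ki) (negbTE kj) preimage_setT probability_setT.
Qed.

(** Independence makes the joint law of [(Y1, Y2)] the product of the two laws, after which Tonelli
    splits the integral. Nonnegativity of [h1] and [h2] takes the place of integrability. *)
Lemma expectation_mul_independent (Y1 Y2 : {mfun Omega >-> T}) (h1 h2 : T -> R) :
  (forall A B, measurable A -> measurable B ->
    P (Y1 @^-1` A `&` Y2 @^-1` B) = (P (Y1 @^-1` A) * P (Y2 @^-1` B))%E) ->
  measurable_fun [set: T] h1 -> measurable_fun [set: T] h2 ->
  (forall x, 0 <= h1 x) -> (forall x, 0 <= h2 x) ->
  ('E_P[(h1 \o Y1) * (h2 \o Y2)] = 'E_P[h1 \o Y1] * 'E_P[h2 \o Y2])%E.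
Proof.
move=> indep mh1 mh2 h10 h20.
have mY12 : measurable_fun [set: Omega] (fun w => (Y1 w, Y2 w)).
  exact: measurable_fun_pair.
pose Y12 : {mfun Omega >-> (T * T)%type} :=
  HB.pack (fun w => (Y1 w, Y2 w)) (isMeasurableFun.Build _ _ _ _ _ mY12).
pose h (z : T * T) := (h1 z.1 * h2 z.2)%:E.
have mh : measurable_fun [set: T * T] h.
  apply/measurable_EFinP; apply: measurable_funM.
    exact: measurableT_comp mh1 measurable_fst.
  exact: measurableT_comp mh2 measurable_snd.
have h0 z : (0 <= h z)%E by rewrite lee_fin mulr_ge0.
rewrite unlock.
transitivity (\int[distribution P Y12]_z h z)%E.
  by rewrite ge0_integral_distribution.
transitivity (\int[distribution P Y1 \x distribution P Y2]_z h z)%E.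
  apply: eq_measure_integral => A mA _; apply/esym.
  (* The two measures agree on measurable rectangles, which determines the product measure. *)
  by apply: product_measure_unique => // B C mB mC; exact: indep.
rewrite fubini_tonelli1//.
transitivity (\int[distribution P Y1]_x ((h1 x)%:E * 'E_P[h2 \o Y2]))%E.
  apply: eq_integral => x _; rewrite /fubini_F /h/=.
  under eq_integral do rewrite EFinM.
  rewrite ge0_integralZl//; first 1 last.
  - exact/measurable_EFinP.
  - by move=> y _; rewrite lee_fin.
  - by rewrite lee_fin.
  rewrite ge0_integral_distribution//; first by rewrite unlock.
  exact/measurable_EFinP.
rewrite ge0_integralZr//; first 1 last.
- exact/measurable_EFinP.
- by move=> x _; rewrite lee_fin.
- by apply: expectation_ge0 => w; exact: h20.
rewrite ge0_integral_distribution// ?unlock//.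
exact/measurable_EFinP.
Qed.

(** Boundedness puts both variables in L2, so the expectations are finite and the difference of two
    equal extended reals is indeed 0. *)
Lemma covariance_independent (Y1 Y2 : {mfun Omega >-> T}) (h : T -> R) (M : R) :
  (forall A B, measurable A -> measurable B ->
    P (Y1 @^-1` A `&` Y2 @^-1` B) = (P (Y1 @^-1` A) * P (Y2 @^-1` B))%E) ->
  measurable_fun [set: T] h -> (forall x, 0 <= h x <= M) ->
  covariance P (h \o Y1) (h \o Y2) = 0%E.
Proof.
move=> indep mh hM.
have L2 (Y : {mfun Omega >-> T}) : h \o Y \in Lfun P 2%:E.
  apply: (@bounded_Lfun2 _ _ _ _ _ M) => [|w]; last exact: hM.
  exact: measurableT_comp.
have L1 Y := Lfun_subset12 (fin_num_measure P _ measurableT) (L2 Y).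
rewrite covarianceE ?Lfun2_mul_Lfun1// expectation_mul_independent//.
- by rewrite subee// fin_numM// expectation_fin_num.
- by move=> x; have /andP[] := hM x.
- by move=> x; have /andP[] := hM x.
Qed.

End independence.

(** * Measurability of coordinate joining and marginals, and comparison of marginals *)

Section measurability.
Context {R : realType} {d : nat}.
Implicit Types (u : {set 'I_d}) (g : d.-tuple R -> R).

Lemma measurable_box (XX : 'I_d -> set R) :
  (forall i, measurable (XX i)) -> measurable (box XX).
Proof.
move=> mXX.
rewrite (_ : box XX = \bigcap_(i in [set: 'I_d]) ((@tnth d R)^~ i @^-1` XX i)).
  apply: fin_bigcap_measurable => // i _.
  by rewrite -[X in measurable X]setTI; exact: measurable_tnth.
by apply/seteqP; split => [x xXX i _|x xXX i]; exact: xXX.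
Qed.

(** [join_coords] reads its arguments through [nth] with default 0, so an index beyond the length
    has to be covered too; there the map is constant. *)
Lemma measurable_nth n (k : nat) :
  measurable_fun [set: n.-tuple R] (fun x => nth 0 x k).
Proof.
have [kn|kn] := ltnP k n.
  rewrite (_ : (fun _ => _) = (@tnth n R)^~ (Ordinal kn)); last first.
    by apply/funext => x; rewrite (tnth_nth 0).
  exact: measurable_tnth.
rewrite (_ : (fun _ => _) = cst 0); first exact: measurable_cst.
by apply/funext => x; rewrite nth_default ?size_tuple.
Qed.

Lemma measurable_join_coords u :
  measurable_fun [set: (#|u|.-tuple R * #|~: u|.-tuple R)%type]
    (fun z => join_coords z.1 z.2).
Proof.
apply/measurable_fun_tnthP => i.
rewrite (_ : _ \o _ = fun z : #|u|.-tuple R * #|~: u|.-tuple R =>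
    if i \in u then nth 0 z.1 (index i (enum u))
    else nth 0 z.2 (index i (enum (~: u)))); last first.
  by apply/funext => z /=; rewrite tnth_mktuple.
case: (i \in u).
- exact: measurableT_comp (@measurable_nth _ _) measurable_fst.
- exact: measurableT_comp (@measurable_nth _ _) measurable_snd.
Qed.

(** The marginal is [fine] applied to an extended real integral over the fibre, and that integral is
    measurable in [xu] by Tonelli. *)
Lemma measurable_marginal u g : measurable_fun [set: _] g ->
  (forall x, 0 <= g x) -> measurable_fun [set: #|u|.-tuple R] (marginal g).
Proof.
move=> mg g0.
apply: (measurableT_comp (fine_measurable measurableT)).
apply: (@measurable_fun_fubini_tonelli_F _ _ _ _ _ lebesgue_tuple
  (fun z : #|u|.-tuple R * #|~: u|.-tuple R => (g (join_coords z.1 z.2))%:E)).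
- apply/measurable_EFinP.
  by apply: (measurableT_comp mg); exact: measurable_join_coords.
- by move=> z; rewrite lee_fin.
Qed.

Lemma marginal_ge0 u g (xu : #|u|.-tuple R) :
  (forall x, 0 <= g x) -> 0 <= marginal g xu.
Proof. by move=> g0; apply: Rintegral_ge0. Qed.

Lemma measurable_join_coords_r u g (xu : #|u|.-tuple R) :
  measurable_fun [set: _] g ->
  measurable_fun [set: #|~: u|.-tuple R] (fun xv => g (join_coords xu xv)).
Proof.
move=> mg; apply: (@measurable_fun_pair2 _ _ _ _ _ _
  (fun z : #|u|.-tuple R * #|~: u|.-tuple R => g (join_coords z.1 z.2))).
by apply: (measurableT_comp mg); exact: measurable_join_coords.
Qed.

(* If [f] has an infinite integral on the fibre, then [marginal f xu] and hence
   the quotient are [0]. *)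
Lemma marginal_ratio_le u (f g : d.-tuple R -> R) (c : R)
    (xu : #|u|.-tuple R) :
  measurable_fun [set: _] f -> measurable_fun [set: _] g ->
  0 <= c -> (forall x, 0 <= g x <= c * f x) -> (forall x, 0 <= f x) ->
  marginal g xu / marginal f xu <= c.
Proof.
move=> mf mg c0 gf f0.
have [->|fxu0] := eqVneq (marginal f xu) 0; first by rewrite invr0 mulr0.
have fxu_gt0 : 0 < marginal f xu by rewrite lt_neqAle eq_sym fxu0 marginal_ge0.
rewrite ler_pdivrMr//.
have mfx := measurable_join_coords_r xu mf.
have mgx := measurable_join_coords_r xu mg.
(* Since [fine] sends both infinities to 0, a positive marginal can only come from a finite
   integral. *)
have int_f : (\int[lebesgue_tuple]_xv (f (join_coords xu xv))%:E < +oo)%E.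
  move: fxu_gt0; rewrite /marginal /Rintegral.
  case: (\int[_]_(_ in _) _)%E => [r _| |]//=; rewrite ?ltry ?ltxx//.
have if_f : lebesgue_tuple.-integrable setT
    (fun xv : #|~: u|.-tuple R => (f (join_coords xu xv))%:E).
  apply/integrableP; split; first exact/measurable_EFinP.
  apply: le_lt_trans int_f; rewrite le_eqVlt; apply/orP; left; apply/eqP.
  by apply: eq_integral => xv _; rewrite gee0_abs ?lee_fin.
have if_cf : lebesgue_tuple.-integrable setT
    (fun xv : #|~: u|.-tuple R => (c * f (join_coords xu xv))%:E).
  by under eq_fun do rewrite EFinM; exact: integrableZl.
(* Domination by [c * f] makes [g] integrable on the fibre, as monotonicity of the real-valued
   integral requires. *)
have if_g : lebesgue_tuple.-integrable setT
    (fun xv : #|~: u|.-tuple R => (g (join_coords xu xv))%:E).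
  apply: (le_integrable _ _ _ if_cf) => //; first exact/measurable_EFinP.
  move=> xv _; have /andP[g0 gle] := gf (join_coords xu xv).
  by rewrite !gee0_abs ?lee_fin// (le_trans g0).
rewrite /marginal -RintegralZl//.
by apply: le_Rintegral => // xv _; have /andP[] := gf (join_coords xu xv).
Qed.

End measurability.

(** * Weights, estimator of the squared probability and pick-freeze terms under the optimal
    density *)

Section optimal_weights.
Context {R : realType} {d : nat}.
Variables (f phi : d.-tuple R -> R) (t p : R).

Lemma psi_itv (x : d.-tuple R) : 0 <= psi phi t x <= 1.
Proof. by rewrite /psi indicE; case: (_ \in _); rewrite ?lexx ?ler01. Qed.

(** As [phi] is measurable on the box only, [psi] alone may fail to be measurable. Since [f]
    vanishes off the box, [psi] can be replaced in the product by the indicator of the exceedance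
    set within the box. *)
Lemma measurable_psiM (XX : 'I_d -> set R) :
  (forall i, measurable (XX i)) -> density_on (box XX) f ->
  measurable_fun (box XX) phi ->
  measurable_fun [set: d.-tuple R] (fun x => psi phi t x * f x).
Proof.
move=> mXX [mf f0 fout _] mphi.
pose D := box XX `&` phi @^-1` [set` `]t, +oo[].
have mD : measurable D by exact: (mphi (measurable_box mXX)).
rewrite (_ : (fun _ => _) = \1_D \* f).
  by apply: measurable_funM => //; exact: measurable_indic.
apply/funext => x /=; have [Bx|Bx] := pselect (box XX x); last first.
  by rewrite fout// !mulr0.
congr (_ * _); rewrite /psi !indicE; congr (_ %:R); congr nat_of_bool.
by apply/idP/idP; rewrite !inE /D/= in_itv/= andbT; [split|case].
Qed.

(** With [K = psi * f] the weight is [K / (p^-1 * K)]: this equals [p] where [K] is nonzero, and 0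
    elsewhere by the convention on division by zero. *)
Lemma weight_g_opt (x : d.-tuple R) : p != 0 ->
  weight f phi t (g_opt f phi t p) x = p * (psi phi t x * f x != 0)%:R.
Proof.
move=> p0; rewrite /weight /g_opt -[p^-1 * _ * _]mulrA.
have [->|K0] := eqVneq (psi phi t x * f x) 0; first by rewrite mul0r mulr0.
by rewrite invfM invrK mulrCA divff// mulr1.
Qed.

Lemma weight_g_opt_itv (x : d.-tuple R) : 0 < p ->
  0 <= weight f phi t (g_opt f phi t p) x <= p.
Proof.
move=> p0; rewrite (weight_g_opt _ (lt0r_neq0 p0)).
by case: (psi phi t x * f x != 0);
  rewrite ?mulr1n ?mulr0n ?mulr1 ?mulr0 lexx ?andbT ltW.
Qed.

Lemma measurable_weight_g_opt : p != 0 ->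
  measurable_fun [set: d.-tuple R] (fun x => psi phi t x * f x) ->
  measurable_fun [set: d.-tuple R] (weight f phi t (g_opt f phi t p)).
Proof.
move=> p0 mK; pose K x := psi phi t x * f x.
rewrite (_ : weight _ _ _ _ = fun x => p * \1_(~` (K @^-1` [set 0])) x).
  apply: measurable_funM => //; apply: measurable_indic.
  by apply: measurableC; rewrite -[X in measurable X]setTI; exact: mK.
apply/funext => x; rewrite weight_g_opt//; congr (_ * _).
rewrite indicE; congr (_ %:R); congr nat_of_bool.
by apply/idP/idP; rewrite inE/= => /eqP.
Qed.

Lemma g_opt_itv (x : d.-tuple R) : 0 <= p -> 0 <= f x ->
  0 <= g_opt f phi t p x <= p^-1 * f x.
Proof.
move=> p0 fx; have /andP[psi0 psi1] := psi_itv x.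
have pV0 : 0 <= p^-1 by rewrite invr_ge0.
rewrite /g_opt -mulrA; apply/andP; split; first by do 2 apply: mulr_ge0 => //.
by rewrite ler_wpM2l// ler_piMl.
Qed.

Lemma measurable_g_opt :
  measurable_fun [set: d.-tuple R] (fun x => psi phi t x * f x) ->
  measurable_fun [set: d.-tuple R] (g_opt f phi t p).
Proof.
move=> mK; rewrite (_ : g_opt _ _ _ _ = fun x => p^-1 * (psi phi t x * f x)).
  exact: measurable_funM.
by apply/funext => x; rewrite /g_opt mulrA.
Qed.

(** The weight differs from [p] only where [psi * f] vanishes; there [g_opt] vanishes as well, so
    [Y] falls in that set with probability 0. *)
Lemma ae_weight_g_opt dO (Omega : measurableType dO) (Q : probability Omega R)
    (Y : {RV Q >-> d.-tuple R}) : p != 0 ->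
  measurable_fun [set: d.-tuple R] (fun x => psi phi t x * f x) ->
  has_density Y (g_opt f phi t p) ->
  \forall w \ae Q, weight f phi t (g_opt f phi t p) (Y w) = p.
Proof.
move=> p0 mK Yg; pose K x := psi phi t x * f x.
have mK0 : measurable (K @^-1` [set 0]).
  by rewrite -[X in measurable X]setTI; exact: mK.
exists (Y @^-1` (K @^-1` [set 0])); split.
- by rewrite -[X in measurable X]setTI; exact: measurable_funPT.
- rewrite -[LHS]/(distribution Q Y _) Yg// integral0_eq// => x /= Kx0.
  by rewrite /g_opt -mulrA -/(K x) Kx0 mulr0.
- move=> w /= wN; apply: contrapT => /eqP Kw; apply: wN.
  by rewrite weight_g_opt// Kw mulr1.
Qed.

(** Almost surely all [N] weights equal [p] at once, a finite intersection of almost sure events.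
    The empirical mean is then [p] and the bracket, an empirical variance, is 0. *)
Lemma ae_p_IS_ub_g_opt dO (Omega : measurableType dO) (Q : probability Omega R)
    (N : nat) (Y : 'I_N -> {RV Q >-> d.-tuple R}) : (0 < N)%N -> p != 0 ->
  measurable_fun [set: d.-tuple R] (fun x => psi phi t x * f x) ->
  (forall n, has_density (Y n) (g_opt f phi t p)) ->
  \forall w \ae Q,
    p_IS_ub f phi t (g_opt f phi t p) (fun n => Y n w) = p ^+ 2.
Proof.
move=> N0 p0 mK Yg.
have NN0 : N%:R != 0 :> R by rewrite pnatr_eq0 -lt0n.
have : \forall w \ae Q, forall n,
    weight f phi t (g_opt f phi t p) (Y n w) = p.
  by apply: filter_forall => n; exact: ae_weight_g_opt.
apply: filterS => w Yw; rewrite /p_IS_ub /p_IS.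
under eq_bigr do rewrite Yw.
under [X in _ - _ * (_ * X - _)]eq_bigr do rewrite Yw.
rewrite !sumr_const card_ord -(mulr_natl p) -(mulr_natl (p ^+ 2)) !mulKf//.
by rewrite subrr mulr0 subr0.
Qed.

Lemma measurable_p_IS_ub dO (Omega : measurableType dO) (g : d.-tuple R -> R)
    (N : nat) (Y : 'I_N -> Omega -> d.-tuple R) :
  measurable_fun [set: d.-tuple R] (weight f phi t g) ->
  (forall n, measurable_fun [set: Omega] (Y n)) ->
  measurable_fun [set: Omega] (fun w => p_IS_ub f phi t g (fun n => Y n w)).
Proof.
move=> mw mY.
have mwY n : measurable_fun [set: Omega] (weight f phi t g \o Y n).
  exact: measurableT_comp.
have mIS : measurable_fun [set: Omega] (fun w => p_IS f phi t g (fun n => Y n w)).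
  apply: measurable_funM => //.
  exact: (@measurable_sum _ _ _ _ _ _ (fun n w => weight f phi t g (Y n w))).
apply: measurable_funB; first exact: measurable_funX.
apply: measurable_funM => //; apply: measurable_funB; last exact: measurable_funX.
apply: measurable_funM => //.
apply: (@measurable_sum _ _ _ _ _ _ (fun n w => weight f phi t g (Y n w) ^+ 2)).
by move=> n; exact: measurable_funX (mwY n).
Qed.

Definition pick_freeze_term (u : {set 'I_d})
    (z : #|u|.-tuple R * (#|~: u|.-tuple R * #|~: u|.-tuple R)) : R :=
  weight f phi t (g_opt f phi t p) (join_coords z.1 z.2.1) *
  weight f phi t (g_opt f phi t p) (join_coords z.1 z.2.2) *
  (marginal (g_opt f phi t p) z.1 / marginal f z.1).

Lemma pick_freeze_term_itv (u : {set 'I_d}) z : 0 < p ->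
  measurable_fun [set: d.-tuple R] f ->
  measurable_fun [set: d.-tuple R] (fun x => psi phi t x * f x) ->
  (forall x, 0 <= f x) -> 0 <= pick_freeze_term (u := u) z <= p.
Proof.
move=> p0 mf mK f0.
have gf x := g_opt_itv (ltW p0) (f0 x).
have g0 x : 0 <= g_opt f phi t p x by have /andP[] := gf x.
have /andP[w10 w1p] := weight_g_opt_itv (join_coords z.1 z.2.1) p0.
have /andP[w20 w2p] := weight_g_opt_itv (join_coords z.1 z.2.2) p0.
have r0 : 0 <= marginal (g_opt f phi t p) z.1 / marginal f z.1.
  by rewrite divr_ge0// marginal_ge0.
have rp : marginal (g_opt f phi t p) z.1 / marginal f z.1 <= p^-1.
  by apply: marginal_ratio_le => //; [exact: measurable_g_opt|
                                      rewrite invr_ge0 ltW].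
apply/andP; split; first by apply: mulr_ge0 => //; exact: mulr_ge0.
(* Writing the bound as [p * p / p] matches the three factors: each weight is at most [p], the ratio
   of marginals at most [p^-1]. *)
rewrite -[leRHS](mulfK (lt0r_neq0 p0) p).
by apply: ler_pM => //; [exact: mulr_ge0|exact: ler_pM].
Qed.

Lemma measurable_pick_freeze_term (u : {set 'I_d}) : 0 < p ->
  measurable_fun [set: d.-tuple R] f ->
  measurable_fun [set: d.-tuple R] (fun x => psi phi t x * f x) ->
  (forall x, 0 <= f x) -> measurable_fun [set: _] (@pick_freeze_term u).
Proof.
move=> p0 mf mK f0.
have g0 x : 0 <= g_opt f phi t p x.
  by have /andP[] := g_opt_itv (ltW p0) (f0 x).
have mw : measurable_fun [set: d.-tuple R] (weight f phi t (g_opt f phi t p)).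
  by apply: measurable_weight_g_opt => //; rewrite gt_eqF.
have mfu := measurable_marginal (u := u) mf f0.
have mgu := measurable_marginal (u := u) (measurable_g_opt mK) g0.
pose S := (#|u|.-tuple R * (#|~: u|.-tuple R * #|~: u|.-tuple R))%type.
have mz1 : measurable_fun [set: S] fst by exact: measurable_fst.
have mz2 : measurable_fun [set: S] snd by exact: measurable_snd.
have mz21 : measurable_fun [set: S] (fun z => z.2.1).
  exact: measurableT_comp measurable_fst mz2.
have mz22 : measurable_fun [set: S] (fun z => z.2.2).
  exact: measurableT_comp measurable_snd mz2.
have mwj (q : S -> #|~: u|.-tuple R) : measurable_fun [set: S] q ->
    measurable_fun [set: S]
      (fun z => weight f phi t (g_opt f phi t p) (join_coords z.1 (q z))).
  move=> mq; apply: (measurableT_comp mw).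
  rewrite (_ : (fun _ => _) = (fun y : #|u|.-tuple R * #|~: u|.-tuple R =>
    join_coords y.1 y.2) \o (fun z : S => (z.1, q z)))//.
  apply: measurableT_comp; first exact: measurable_join_coords.
  exact: measurable_fun_pair.
apply: measurable_funM; first by apply: measurable_funM; exact: mwj.
apply: measurable_funM; first exact: measurableT_comp mgu mz1.
(* On nonnegative reals the inverse, including its value 0 at 0, is the power of exponent -1, so
   measurability of powers applies. *)
rewrite (_ : (fun _ => _) = fun z : S => marginal f z.1 `^ (-1)); last first.
  by apply/funext => z; rewrite powR_inv1// marginal_ge0.
apply: (@measurableT_comp _ _ _ _ _ _ (@powR R ^~ (-1))).
  exact: measurable_powR.
exact: measurableT_comp mfu mz1.
Qed.

End optimal_weights.

Theorem mainTheorem3 (R : realType) (d : nat)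
  (XX : 'I_d -> set R) (hXX : forall i, measurable (XX i))
  (f : d.-tuple R -> R) (hf : density_on (box XX) f)
  (dP : measure_display) (OmegaP : measurableType dP)
  (P : probability OmegaP R) (X : {RV P >-> d.-tuple R})
  (hXin : forall w, box XX (X w)) (hX : has_density X f)
  (phi : d.-tuple R -> R) (hphi : measurable_fun (box XX) phi) (t : R)
  (hp : 0 < exceedance_prob X phi t)
  (u : {set 'I_d}) (hu0 : u <> finset.set0) (huT : u <> finset.setT)
  (N Nu : nat) (hN : (2 <= N)%N) (hNu : (1 <= Nu)%N)
  (dQ : measure_display) (OmegaQ : measurableType dQ)
  (Q : probability OmegaQ R)
  (Xu : 'I_Nu -> {RV Q >-> #|u|.-tuple R})
  (X1 X2 : 'I_Nu -> {RV Q >-> #|~: u|.-tuple R})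
  (XN : 'I_N -> {RV Q >-> d.-tuple R})
  (hPF : pick_freeze_sample (g_opt f phi t (exceedance_prob X phi t)) Xu X1 X2)
  (hIS : iid_sample (g_opt f phi t (exceedance_prob X phi t)) XN) :
  ('V_Q[fun w => TVE_PF_IS f phi t (g_opt f phi t (exceedance_prob X phi t))
                   (fun n => Xu n w) (fun n => X1 n w) (fun n => X2 n w)
                   (fun n => XN n w)]
   <= (exceedance_prob X phi t ^+ 2 / Nu%:R)%:E)%E.
Proof.
have mK := measurable_psiM t hXX hf hphi.
move: hf hPF hIS hp => [mf f0 _ _] [indep _ _] [_ XNg].
(* The probability is abstracted into a positive real [p]; the bounds below hold for [g_opt]
   normalised by any such [p]. *)
move: (exceedance_prob X phi t) XNg => p XNg p0.
pose Tu := (#|u|.-tuple R * (#|~: u|.-tuple R * #|~: u|.-tuple R))%type.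
have mY n : measurable_fun [set: OmegaQ] (fun w => (Xu n w, (X1 n w, X2 n w))).
  by apply: measurable_fun_pair => //; exact: measurable_fun_pair.
pose Y n : {mfun OmegaQ >-> Tu} := HB.pack (fun w => (Xu n w, (X1 n w, X2 n w)))
  (isMeasurableFun.Build _ _ _ _ _ (mY n)).
pose h : Tu -> R := pick_freeze_term f phi t p (u := u).
have hp z : 0 <= h z <= p by exact: pick_freeze_term_itv.
have mh : measurable_fun [set: Tu] h by exact: measurable_pick_freeze_term.
pose Z n := h \o Y n.
have mZ n : measurable_fun [set: OmegaQ] (Z n) by exact: measurableT_comp.
(* Distinct summands apply the bounded map [h] to independent triples, hence are uncorrelated. *)
have covZ i j : i != j -> covariance Q (Z i) (Z j) = 0%E.
  move=> ij; apply: (covariance_independent _ mh hp) => A B mA mB.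
  exact: mutually_independent_pair indep ij mA mB.
have mS : measurable_fun [set: OmegaQ] (fun w => \sum_(n < Nu) Z n w).
  exact: measurable_sum.
have mw : measurable_fun [set: d.-tuple R] (weight f phi t (g_opt f phi t p)).
  by apply: measurable_weight_g_opt; rewrite ?lt0r_neq0.
have SE : \sum_(n < Nu) Z n = fun w => \sum_(n < Nu) Z n w.
  by apply/funext => w; rewrite fct_sumE.
have Z2 n : Z n \in Lfun Q 2%:E.
  exact: bounded_Lfun2 (mZ n) (fun w => hp (Y n w)).
have S2 : Nu%:R^-1 \o* \sum_(n < Nu) Z n \in Lfun Q 2%:E.
  by rewrite Lfun_scale ?ler1n// rpred_sum ?lee1n.
apply: le_trans (variance_mean_le hNu mZ (fun n w => hp (Y n w)) covZ).
(* Subtracting the constant [p ^+ 2] from the average leaves its variance unchanged and makes it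
   almost surely equal to the estimator, so this comparison is an equality. *)
rewrite -(varianceB_cst_r (p ^+ 2) S2) le_eqVlt; apply/orP; left; apply/eqP.
apply: ae_eq_variance.
- apply: measurable_funB; first exact: measurable_funM.
  by apply: measurable_p_IS_ub => //.
- rewrite SE; apply: (measurable_funB _ (measurable_cst _)).
  exact: measurable_funM mS (measurable_cst _).
- apply: filterS (ae_p_IS_ub_g_opt (ltnW hN) (lt0r_neq0 p0) mK XNg) => w p2.
  (* The commutation is due to [\o*], which multiplies by the scalar on the right. *)
  by rewrite /TVE_PF_IS p2 SE /= mulrC.
Qed.
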